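(* Let $(\ell_n)$ be the Lucas numbers, defined by $\ell_0=2$, $\ell_1=1$, $\ell_2=3$ and $\ell_n=\ell_{n-1}+\ell_{n-2}$ for $n\ge 3$. For an integer $n\ge 3$, let $a=\frac{1+\sqrt5}{2}$, $b=\frac{1-\sqrt5}{2}$, and let $A=(A_{ij})_{1\le i,j\le n}$ be the $n\times n$ matrix $$A=\left(\begin{array}{cccccc} 1 & (-1)^{n+1}a & 0 & \cdots & 0 & b\\ (-1)^{n+1}b & 1 & a & \cdots & 0 & 0\\ 0 & b & 1 & \cdots & 0 & 0\\ \vdots & \vdots & \vdots & \ddots & \vdots & \vdots\\ 0 & 0 & 0 & \cdots & 1 & a\\ a & 0 & 0 & \cdots & b & 1 \end{array}\right),$$ that is, $A_{ii}=1$ for $1\le i\le n$; $A_{12}=(-1)^{n+1}a$ and $A_{21}=(-1)^{n+1}b$; $A_{i,i+1}=a$ and $A_{i+1,i}=b$ for $2\le i\le n-1$; $A_{1n}=b$ and $A_{n1}=a$; and all other entries are $0$. Then $$\ell_n=\tfrac12\det(A).$$ *)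

(* Defs.v *)
From mathcomp Require Import all_boot all_order all_algebra.

Set Implicit Arguments.
Unset Strict Implicit.
Unset Printing Implicit Defensive.

Import GRing.Theory Num.Theory.

Fixpoint lucas (n : nat) : nat :=
  match n with
  | 0 => 2
  | m.+1 => match m with
            | 0 => 1
            | k.+1 => lucas m + lucas k
            end
  end.

Fact lucas2 : lucas 2 = 3. Proof. by []. Qed.

Fact lucasSS (n : nat) : lucas n.+2 = lucas n.+1 + lucas n. Proof. by []. Qed.

Local Open Scope ring_scope.

Definition golden (R : rcfType) : R := (1 + Num.sqrt 5%:R) / 2%:R.

Definition golden_conj (R : rcfType) : R := (1 - Num.sqrt 5%:R) / 2%:R.

(* The entry in row p and column q, both numbered from 1 to n.  The cases are *)
(* mutually exclusive when 3 <= n, so their order is immaterial there.        *)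
Definition lucas_entry (R : rcfType) (n p q : nat) : R :=
  let a := golden R in
  let b := golden_conj R in
  if p == q then 1
  else if (p == 1%N) && (q == 2%N) then (-1) ^+ n.+1 * a
  else if (p == 2%N) && (q == 1%N) then (-1) ^+ n.+1 * b
  else if (2 <= p)%N && (q == p.+1) then a
  else if (2 <= q)%N && (p == q.+1) then b
  else if (p == 1%N) && (q == n) then b
  else if (p == n) && (q == 1%N) then a
  else 0.

(* Ordinals are numbered from 0, hence the successors. *)
Definition lucas_mx (R : rcfType) (n : nat) : 'M[R]_n :=
  \matrix_(i < n, j < n) lucas_entry R n i.+1 j.+1.

(* Main.v *)
Require Import Defs.
From mathcomp Require Import all_boot all_order all_algebra.
From mathcomp Require Import zify ring.

Set Implicit Arguments.
Unset Strict Implicit.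
Unset Printing Implicit Defensive.

Import GRing.Theory Num.Theory.

Local Open Scope ring_scope.

(** The matrix factors.  Put s = (-1)^(n+1) and let P be the cyclic shift
    matrix, with ones at the places (i, i+1) and (n, 1), except that its entry
    at (1, 2) is s.  Since s^2 = 1, P is orthogonal, and the given matrix is
    (a + b) I + a P + b P^T because a + b = 1; hence it equals

      (I + P) (a I + b P^T).

    A matrix u I + v P has only two nonzero terms in its Leibniz expansion, one
    for the identity and one for the n-cycle ([det_cyclic_bidiagonal]).  The
    sign of the n-cycle is s and so is the product of the nonzero entries of P,
    so the two signs cancel and det (u I + v P) = u^n + v^n
    ([det_scalar_add_shift]).  The two factors therefore have determinants
    1 + 1 = 2 and a^n + b^n, and the latter is the Lucas number by Binet's
    formula ([lucas_binet]). *)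

(** * Cyclic bidiagonal matrices *)

Section CyclicBidiagonal.

Variables (R : comNzRingType) (k : nat).
Implicit Types x y : 'I_k.+2 -> R.

Definition cyclic_bidiagonal x y : 'M[R]_k.+2 :=
  \matrix_(i, j) (x i *+ (i == j) + y i *+ (j == ordS i)).

Lemma eq_ordS (i j : 'I_k.+2) :
  (j == ordS i) =
  (j == i.+1 :> nat) || (i == k.+1 :> nat) && (j == 0 :> nat).
Proof.
rewrite -val_eqE /=; have := ltn_ord i; have := ltn_ord j.
case: (i =P k.+1 :> nat) => [->|ne_ik] *; first by rewrite modnn; lia.
by rewrite modn_small; lia.
Qed.

(** In the first column only the first and the last entries are nonzero;
    deleting that column together with the first (last) row leaves an upper
    (lower) triangular matrix with the remaining x (y) on its diagonal. *)
Lemma det_cyclic_bidiagonal x y :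
  \det (cyclic_bidiagonal x y) = \prod_i x i + (-1) ^+ k.+1 * \prod_i y i.
Proof.
have ne0max : ord_max != ord0 :> 'I_k.+2 by [].
rewrite (expand_det_col _ ord0) (bigD1 ord0) //= (bigD1 ord_max) //=.
rewrite big1 ?addr0 => [|i /andP[ne_i0 ne_im]]; last first.
  rewrite mxE (negPf ne_i0) eq_ordS /=.
  by rewrite [i == _ :> nat](negPf ne_im) addr0 mul0r.
rewrite !mxE !eq_ordS -!val_eqE /= eqxx addr0 add0r.
congr (_ + _).
  (* The minor is upper triangular, while [det_trig] asks for lower. *)
  rewrite /cofactor expr0 mul1r -det_tr det_trig.
    rewrite [in RHS]big_ord_recl; congr (_ * _); apply: eq_bigr => /= i _.
    rewrite !mxE eq_ordS -!val_eqE /= /bump.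
    by do ![case: eqP => ?] => /=; rewrite ?addr0 //; lia.
  apply/is_trig_mxP => /= i j lt_ij.
  rewrite !mxE eq_ordS -!val_eqE /= /bump.
  by do ![case: eqP => ?] => /=; rewrite ?addr0 //; lia.
rewrite /cofactor /= addn0 det_trig.
  rewrite mulrCA [in RHS]big_ord_recr /= [_ * y _]mulrC.
  congr (_ * (_ * _)); apply: eq_bigr => /= i _.
  have -> : widen_ord (leqnSn k.+1) i = lift ord_max i.
    by apply: val_inj; rewrite /= /bump leqNgt ltn_ord.
  rewrite !mxE eq_ordS -!val_eqE /= /bump; have lt_ik := ltn_ord i.
  by do ![case: eqP => ?] => /=; rewrite ?add0r //; lia.
apply/is_trig_mxP => /= i j lt_ij.
rewrite !mxE eq_ordS -!val_eqE /= /bump.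
have lt_ik := ltn_ord i; have lt_jk := ltn_ord j.
by do ![case: eqP => ?] => /=; rewrite ?add0r //; lia.
Qed.

(** The sign is that of an n-cycle, n = k.+2, so that it cancels against the
    sign in [det_cyclic_bidiagonal]; it sits in the first row because that is
    where the matrix of the theorem carries its sign. *)
Definition shift_weight (i : 'I_k.+2) : R :=
  if i == ord0 then (-1) ^+ k.+1 else 1.

Definition signed_shift : 'M[R]_k.+2 :=
  \matrix_(i, j) (shift_weight i *+ (j == ordS i)).

Lemma signed_shift_orthogonal : signed_shift *m signed_shift^T = 1%:M.
Proof.
apply/matrixP=> i j; rewrite !mxE (bigD1 (ordS i)) //= big1 => [|l ne_l].
  rewrite !mxE eqxx addr0 (inj_eq (@ordS_inj _)).
  case: eqP => [<-|_]; last by rewrite mulr0.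
  by rewrite /shift_weight; case: ifP; rewrite ?mulr1 // -expr2 sqrr_sign.
by rewrite !mxE (negPf ne_l) mul0r.
Qed.

Lemma det_scalar_add_shift u v :
  \det (u%:M + v *: signed_shift) = u ^+ k.+2 + v ^+ k.+2.
Proof.
have -> : u%:M + v *: signed_shift =
    cyclic_bidiagonal (fun=> u) (fun i => v * shift_weight i).
  by apply/matrixP=> i j; rewrite !mxE mulrnAr.
rewrite det_cyclic_bidiagonal big_split /= !prodr_const !card_ord.
congr (_ + _); rewrite (bigD1 ord0) //= big1 => [|i ne_i0]; last first.
  by rewrite /shift_weight (negPf ne_i0).
by rewrite /shift_weight eqxx mulr1 mulrCA -expr2 sqrr_sign mulr1.
Qed.

End CyclicBidiagonal.

(** * The golden ratio and the factorization *)

Section Golden.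

Variable R : rcfType.
Local Notation a := (golden R).
Local Notation b := (golden_conj R).

Lemma golden_add_conj : a + b = 1.
Proof. by rewrite /golden /golden_conj; field. Qed.

Lemma sqr_golden : a ^+ 2 = a + 1.
Proof.
have sq5 : Num.sqrt 5%:R ^+ 2 = 5%:R :> R by rewrite sqr_sqrtr ?ler0n.
by rewrite /golden expr_div_n sqrrD sq5; field.
Qed.

Lemma sqr_golden_conj : b ^+ 2 = b + 1.
Proof.
have -> : b = 1 - a by rewrite -golden_add_conj addrC addKr.
by rewrite sqrrB sqr_golden; ring.
Qed.

Lemma lucas_binet n : (lucas n)%:R = a ^+ n + b ^+ n.
Proof.
suff [] : (lucas n)%:R = a ^+ n + b ^+ n /\
          (lucas n.+1)%:R = a ^+ n.+1 + b ^+ n.+1 by [].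
elim: n => [|n [IH0 IH1]]; first by rewrite !expr1 golden_add_conj.
split=> //; rewrite lucasSS natrD IH0 IH1.
rewrite -(addn2 n) !exprD sqr_golden sqr_golden_conj !exprS.
by ring.
Qed.

(** Expanding the product gives a I + b P^T + a P + b P P^T, and P P^T = I turns
    the last term into a second multiple of the identity.  The factor 1 in front
    of the first shift keeps both factors in the form treated by
    [det_scalar_add_shift]. *)
Lemma lucas_mx_factor k :
  lucas_mx R k.+3 = (1%:M + 1 *: signed_shift R k.+1) *m
                    (a%:M + b *: signed_shift R k.+1)^T.
Proof.
rewrite scale1r linearD linearZ /= tr_scalar_mx mulmxDl mul1mx mulmxDr.
rewrite -scalemxAr signed_shift_orthogonal mul_mx_scalar.
apply/matrixP=> i j; rewrite !mxE /lucas_entry /shift_weight.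
rewrite !eq_ordS -!val_eqE /= !eqSS [(-1) ^+ k.+4]exprS [(-1) ^+ k.+3]exprS.
rewrite !mulN1r opprK; have lt_ik := ltn_ord i; have lt_jk := ltn_ord j.
rewrite !ltnS !lt0n; set s := _ ^+ _.
(* Most truth assignments to the index equations are contradictory; in the
   remaining ones both entries agree, on the diagonal because a + b = 1. *)
do ![case: eqP => ? /=; try by exfalso; lia];
  rewrite ?mulr0n ?mulr1n ?mulr0 ?mulr1 ?addr0 ?add0r ?golden_add_conj //;
  exact: mulrC.
Qed.

End Golden.

Theorem corollary8 (R : rcfType) (n : nat) (hn : (3 <= n)%N) :
  (lucas n)%:R = 2%:R^-1 * \det (lucas_mx R n).
Proof.
case: n hn => [|[|[|k]]] // _.
rewrite lucas_mx_factor det_mulmx det_tr !det_scalar_add_shift !expr1n.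
by rewrite -lucas_binet mulKf // pnatr_eq0.
Qed.
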